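(* Let $\gamma:\mathbb R\to\mathbb R_+$ be a smooth function. Consider the problem of minimizing $$H(\rho)=\int_0^1h_{\mathbb R}(\rho_t)\,dt$$ over measurable families $(\rho_t)_{t\in[0,1]}$ of densities on $\mathbb R$ subject to the constraints: (1) $\int_{\mathbb R}\rho_t(x)dx=1$ for each $t\in[0,1]$; (2) for each $x\in\mathbb R$, the solution $v(t,y)=v^x(t,y)$ of the transport equation $$\partial_tv(t,y)=\rho_t(x)\,\partial_yv(t,y),\qquad v(0,y)=y,$$ satisfies $\lim_{y\to0+}v(1,y)=\gamma(x)$. A solution to this problem exists if and only if $\int_{\mathbb R}\gamma(x)dx=1$ and $h_{\mathbb R}(\gamma)<\infty$, in which case the solution is constant in $t$, $$\rho_t^*(x)\equiv\gamma(x),$$ and the minimal entropy equals the entropy of $\gamma$: $H^*=h_{\mathbb R}(\gamma)$.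
   Context: $h_{\mathbb R}(f)=\int_{\mathbb R}f\log f\,dx$ (with $0\log0=0$); the condition $h_{\mathbb R}(\gamma)<\infty$ is understood as: the integral is well defined and finite. Densities are nonnegative functions. In the transport equation $x$ is a parameter, and the equation is understood in the integrated (absolutely continuous in $t$) sense. A solution to the problem is an admissible family $\rho$ (satisfying the constraints) with $H(\rho)$ well defined and finite that attains the infimum $H^*$ of $H$ over admissible families for which $H$ is well defined; it is identified up to modification on Lebesgue-null sets of $(t,x)$. *)

(* Defs.v *)
From HB Require Import structures.
From mathcomp Require Import all_boot all_order all_algebra.
From mathcomp Require Import all_classical all_reals all_analysis.
Set Implicit Arguments. Unset Strict Implicit. Unset Printing Implicit Defensive.
Import Order.TTheory GRing.Theory Num.Theory.
Import numFieldNormedType.Exports.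
Local Open Scope classical_set_scope.
Local Open Scope ring_scope.

Definition smooth (R : realType) (f : R -> R) : Prop :=
  forall (n : nat) (x : R), derivable (derive1n n f) x 1.

(* The convention [+oo - +oo = -oo] gives every extended real integral a value;
   this predicate excludes the case where that convention is used. *)
Definition integral_defined (R : realType) (D : set R) (f : R -> \bar R) : Prop :=
  (\int[lebesgue_measure]_(x in D) f^\+ x < +oo)%E \/
  (\int[lebesgue_measure]_(x in D) f^\- x < +oo)%E.

Definition ent_integrand (R : realType) (f : R -> R) (x : R) : \bar R :=
  (f x * ln (f x))%:E.

Definition ent (R : realType) (f : R -> R) : \bar R :=
  (\int[lebesgue_measure]_x ent_integrand f x)%E.

Definition ent_defined (R : realType) (f : R -> R) : Prop :=
  integral_defined setT (ent_integrand f).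

Definition total_ent (R : realType) (rho : R -> R -> R) : \bar R :=
  (\int[lebesgue_measure]_(t in `[0%R, 1%R]) ent (rho t))%E.

Definition total_ent_defined (R : realType) (rho : R -> R -> R) : Prop :=
  {ae lebesgue_measure, forall t : R, 0 <= t <= 1 -> ent_defined (rho t)} /\
  integral_defined `[0, 1] (fun t : R => ent (rho t)).

(* Solutions of [d_t v = a(t) d_y v], [v(0, y) = y], on [0, 1] x ]0, +oo[,
   integrated in t: C^1 in y, with d_y v jointly continuous, and absolutely
   continuous in t.  No integrability of [a] is assumed. *)
Definition transport_solution (R : realType) (a : R -> R) (v : R -> R -> R) : Prop :=
  [/\ forall t y : R, 0 <= t <= 1 -> 0 < y -> derivable (v t) y 1,
      {within `[0, 1] `*` `]0, +oo[, continuous (fun p : R * R => derive1 (v p.1) p.2)},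
      forall y : R, 0 < y ->
        lebesgue_measure.-integrable `[0, 1] (fun s : R => (a s * derive1 (v s) y)%:E),
      forall y : R, 0 < y -> v 0 y = y
    & forall t y : R, 0 <= t <= 1 -> 0 < y ->
        v t y = v 0 y + \int[lebesgue_measure]_(s in `[0, t]) (a s * derive1 (v s) y)].

Definition transport_constraint (R : realType) (gamma : R -> R) (rho : R -> R -> R) : Prop :=
  forall x : R,
    (exists v, transport_solution (rho ^~ x) v) /\
    (forall v, transport_solution (rho ^~ x) v ->
       v 1 y @[y --> 0^'+] --> gamma x).

Definition measurable_density_family (R : realType) (rho : R -> R -> R) : Prop :=
  measurable_fun ((`[0%R, 1%R]%classic : set (measurableTypeR R)) `*`
                  [set: measurableTypeR R])
    (fun p => rho p.1 p.2) /\
  (forall t x : R, 0 <= t <= 1 -> 0 <= rho t x).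

Definition admissible (R : realType) (gamma : R -> R) (rho : R -> R -> R) : Prop :=
  [/\ measurable_density_family rho,
      forall t : R, 0 <= t <= 1 -> (\int[lebesgue_measure]_x (rho t x)%:E = 1)%E
    & transport_constraint gamma rho].

Definition min_total_ent (R : realType) (gamma : R -> R) : \bar R :=
  ereal_inf [set total_ent rho | rho in
    [set rho | admissible gamma rho /\ total_ent_defined rho]].

Definition is_solution (R : realType) (gamma : R -> R) (rho : R -> R -> R) : Prop :=
  [/\ admissible gamma rho, total_ent_defined rho,
      total_ent rho \is a fin_num & total_ent rho = min_total_ent gamma].

Definition ae_eq_strip (R : realType) (rho1 rho2 : R -> R -> R) : Prop :=
  {ae (lebesgue_measure \x lebesgue_measure)%E, forall p : R * R,
    0 <= p.1 <= 1 -> rho1 p.1 p.2 = rho2 p.1 p.2}.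

(* Main.v *)
(* Along the characteristics [y + A(1) - A(t)], [A(t) = int_0^t rho_s(x) ds], a
   solution of the transport equation is constant; hence [v(t, y) = y + A(t)] as
   long as [A(t)] is finite, so [d_y v = 1] there, and continuity of [d_y v]
   together with integrability of [rho d_y v] propagates the finiteness of [A] up
   to time 1.  The constraint (2) thus says [int_0^1 rho_t(x) dt = gamma(x)].

   If [gamma] has finite entropy, integrating the tangent inequality
   [u ln u >= u ln gamma + u - gamma] over the strip gives [H(rho) >= h(gamma)].

   Conversely let [rho] be any minimizer.  Averaging [rho] with its rotation in
   time by [s] modulo 1 preserves all the constraints, and lowers [H] by the
   integral of the convexity gap of [u ln u], which is bounded by [ln 2] times
   the averaged density, hence integrable.  So the gap vanishes and
   [rho_t(x) = rho_(t + s)(x)] a.e. for every [s]; integrating in [s] yields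
   [rho_t(x) = gamma(x)] a.e.  No assumption on the entropy of [gamma] enters, so
   the same argument shows that [gamma] has finite entropy. *)
Require Import Defs.
From HB Require Import structures.
From mathcomp Require Import all_boot all_order all_algebra.
From mathcomp Require Import all_classical all_reals all_analysis.
From mathcomp Require Import measurable_realfun.
From mathcomp Require Import ring lra.
Import Order.TTheory GRing.Theory Num.Theory.
Import numFieldNormedType.Exports.
Local Open Scope classical_set_scope.
Local Open Scope ring_scope.
Set Implicit Arguments.
Unset Strict Implicit.

(** Real induction. The neighbourhood given at the supremum of the times [s] with [P 0 s] meets that
    set on its left and reaches past the supremum on its right, unless the supremum is [T]. *)
Lemma itv_chaining {R : realType} (T : R) (P : R -> R -> Prop) : 0 <= T ->
    (forall a b c, P a b -> P b c -> P a c) ->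
    (forall s, 0 <= s <= T -> exists2 d, 0 < d & forall s1 s2,
      0 <= s1 -> s1 <= s2 -> s2 <= T -> `|s1 - s| < d -> `|s2 - s| < d ->
      P s1 s2) ->
  P 0 T.
Proof.
move=> T0 Ptrans Ploc.
pose S := [set s | 0 <= s <= T /\ P 0 s].
have S0 : S 0.
  split; first by rewrite lexx.
  have [|d d0] := Ploc 0; first by rewrite lexx.
  by apply; rewrite ?subrr ?normr0.
have ubS : ubound S T by move=> s [/andP[]].
have supS : has_sup S by split; [exists 0|exists T].
have m0 : 0 <= sup S by apply: ub_le_sup => //; exists T.
have mT : sup S <= T by apply: ge_sup => //; exists 0.
have [|d d0 Pd] := Ploc (sup S); first by rewrite m0.
have [s1 [/andP[s10 s1T] Ps1] ms1] := sup_adherent d0 supS.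
have s1m : s1 <= sup S by apply: ub_le_sup; [exists T|split => //; rewrite s10].
(* Half a radius past the supremum, capped at [T]. Since [s2] turns out to lie in [S], it cannot
   exceed the supremum, so the cap must be active. *)
pose s2 := Num.min T (sup S + d / 2).
have s2T : s2 <= T by rewrite ge_min lexx.
have s2m : s2 <= sup S + d / 2 by rewrite ge_min lexx orbT.
have ms2 : sup S <= s2 by rewrite le_min mT lerDl divr_ge0// ltW.
have Ps2 : P 0 s2.
  apply: Ptrans Ps1 _; apply: Pd => //; first by rewrite (le_trans s1m).
  - by rewrite ler0_norm ?subr_le0//; lra.
  - by rewrite ger0_norm ?subr_ge0//; lra.
have Ss2 : S s2 by split => //; rewrite (le_trans m0).
have s2le : s2 <= sup S by apply: ub_le_sup => //; exists T.
suff <- : s2 = T by [].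
apply/eqP; rewrite eq_le s2T /= leNgt; apply/negP => s2lt.
move: s2le; rewrite /s2 minElt; case: ifPn => [Tl|_].
  by move: s2lt; rewrite /s2 minElt Tl ltxx.
by rewrite leNgt ltrDl divr_gt0.
Qed.

(** * The transport equation along characteristics *)

Section transport.
Context {R : realType}.
Local Notation mu := (@lebesgue_measure R).
Implicit Types (a : R -> R) (v : R -> R -> R).

Lemma Rintegral_itv_split a (T s1 s2 : R) : 0 <= s1 -> s1 <= s2 -> s2 <= T ->
    mu.-integrable `[0, T] (EFin \o a) ->
  \int[mu]_(r in `[0, s2]) a r =
    \int[mu]_(r in `[0, s1]) a r + \int[mu]_(r in `]s1, s2]) a r.
Proof.
move=> s10 s12 s2T ia.
rewrite -(@Rintegral_itvB _ _ (BLeft 0) (BRight s2) s1) ?bnd_simp//; first lra.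
by apply: integrableS ia => //; apply: subset_itvl; rewrite bnd_simp.
Qed.

(** One radius serves both variables, and times are restricted to the closed unit interval, so the
    estimate also holds at its end points. *)
Lemma ts_continuous a v (s z : R) : transport_solution a v -> 0 <= s <= 1 -> 0 < z ->
  forall e : R, 0 < e -> exists2 d : R, 0 < d & forall r y, 0 <= r <= 1 -> 0 < y ->
    `|r - s| < d -> `|y - z| < d -> `|derive1 (v r) y - derive1 (v s) z| < e.
Proof.
move=> [_ cw _ _ _] s01 z0 e e0.
have Dsz : (`[0, 1] `*` `]0, +oo[)%classic (s, z).
  by split; rewrite /= in_itv/= ?s01 ?z0.
move: cw => /subspace_continuousP /(_ _ Dsz).
move=> /cvgrPdist_lt /(_ e e0).
rewrite near_withinE => -[[U V] /= [/nbhs_ballP[d1 /= d10 sU] /nbhs_ballP[d2 /= d20 zV]] UV].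
exists (Num.min d1 d2); first by rewrite lt_min d10.
move=> r y r01 y0; rewrite !lt_min => /andP[rd1 _] /andP[_ yd2].
rewrite distrC; apply: (UV (r, y)) => /=.
  by split; [apply: sU|apply: zV]; rewrite /ball/= distrC.
by split; rewrite /= in_itv/= ?r01 ?y0.
Qed.

Lemma ts_is_derive a v (t y : R) : transport_solution a v -> 0 <= t <= 1 -> 0 < y ->
  is_derive y 1 (v t) (derive1 (v t) y).
Proof.
move=> [dv _ _ _ _] t01 y0; rewrite derive1E.
by apply: derivableP; exact: dv.
Qed.

Lemma ts_MVT a v (t y1 y2 : R) : transport_solution a v -> 0 <= t <= 1 -> 0 < y1 -> y1 <= y2 ->
  exists2 c, y1 <= c <= y2 & v t y2 - v t y1 = derive1 (v t) c * (y2 - y1).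
Proof.
move=> av t01 y10 y12.
have [| |c + cE] := @MVT_segment R (v t) (derive1 (v t)) y1 y2 y12.
- move=> x; rewrite in_itv/= => /andP[x1 _].
  by apply: ts_is_derive av t01 _; rewrite (lt_trans y10).
- apply: derivable_within_continuous => x; rewrite in_itv/= => /andP[x1 _].
  by case: av => dv _ _ _ _; apply: dv => //; rewrite (lt_le_trans y10).
- by rewrite in_itv/= => c12; exists c.
Qed.

(* Along the characteristic [Y] the time increment of [v] and its mean value
   increment in [y] both carry the factor [A s2 - A s1], with coefficients
   [d_y v] at nearby points and opposite signs. *)
Lemma ts_characteristic_loc a v (T y e : R) : transport_solution a v ->
    (forall t, 0 <= t <= 1 -> 0 <= a t) ->
    0 <= T <= 1 -> mu.-integrable `[0, T] (EFin \o a) -> 0 < y -> 0 < e ->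
  let A t := \int[mu]_(r in `[0, t]) a r in
  let Y t := y + (A T - A t) in
  forall s, 0 <= s <= T -> exists2 d, 0 < d & forall s1 s2,
      0 <= s1 -> s1 <= s2 -> s2 <= T -> `|s1 - s| < d -> `|s2 - s| < d ->
    A s1 <= A s2 /\ `|v s2 (Y s2) - v s1 (Y s1)| <= e * (A s2 - A s1).
Proof.
move=> av a0 /andP[T0 T1] ia y0 e0 A Y s /andP[s0 sT].
have AE t : A t = \int[mu]_(r in `[0, t]) a r by [].
have YE t : Y t = y + (A T - A t) by [].
clearbody A Y.
have Amono s1 s2 : 0 <= s1 -> s1 <= s2 -> s2 <= T -> A s1 <= A s2.
  move=> s10 s12 s2T; rewrite !AE (@Rintegral_itv_split _ _ _ _ s10 s12 s2T ia).
  rewrite lerDl; apply: Rintegral_ge0 => r /=; rewrite in_itv/= => /andP[r1 r2].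
  by apply: a0; lra.
have Ypos t : 0 <= t -> t <= T -> 0 < Y t.
  by move=> t0 tT; rewrite !YE ltr_pwDl// subr_ge0 Amono.
have s01 : 0 <= s <= 1 by rewrite s0 (le_trans sT).
have e20 : 0 < e / 2 by rewrite divr_gt0.
have [d1 d10 cw] := ts_continuous av s01 (Ypos _ s0 sT) e20.
(* Continuity of [A] keeps the characteristic [Y] within [d1] of [Y s], where [d_y v] is
   controlled. *)
have [d2 d20 cA] : exists2 d2, 0 < d2 & forall r, 0 <= r -> r <= T ->
    `|r - s| < d2 -> `|A r - A s| < d1.
  have Ds : (`[0, T]%classic : set R) s by rewrite /= in_itv/= s0.
  have /subspace_continuousP /(_ _ Ds) := parameterized_integral_continuous T0 ia.
  move=> /cvgrPdist_lt /(_ d1 d10); rewrite near_withinE => /nbhs_ballP[d2 /= d20 h].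
  exists d2 => // r r0 rT rs; rewrite distrC !AE; apply: h => /=.
    by rewrite /ball/= distrC.
  by rewrite in_itv/= r0.
exists (Num.min d1 d2); first by rewrite lt_min d10.
move=> s1 s2 s10 s12 s2T; rewrite !lt_min => /andP[s1d1 s1d2] /andP[s2d1 s2d2].
have A12 := Amono _ _ s10 s12 s2T.
split => //.
have s1T : s1 <= T := le_trans s12 s2T.
have s20 : 0 <= s2 := le_trans s10 s12.
have Y1d : `|Y s1 - Y s| < d1.
  by rewrite (_ : _ - _ = - (A s1 - A s)) ?normrN ?cA// !YE; ring.
have Y2d : `|Y s2 - Y s| < d1.
  by rewrite (_ : _ - _ = - (A s2 - A s)) ?normrN ?cA// !YE; ring.
have Y21 : Y s2 <= Y s1 by rewrite !YE lerD2l lerD2l lerN2.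
have s1_01 : 0 <= s1 <= 1 by rewrite s10 (le_trans s1T).
(* The increment in [y] is taken at the earlier time [s1], the increment in [t] below at the later
   position [Y s2]. *)
have [c /andP[c1 c2] cE] := ts_MVT av s1_01 (Ypos _ s20 s2T) Y21.
set w := derive1 (v s) (Y s) in cw.
have wc : `|derive1 (v s1) c - w| < e / 2.
  apply: cw => //; first by rewrite (lt_le_trans _ c1)// Ypos.
  by move: Y1d Y2d; rewrite !ltr_norml => /andP[? ?] /andP[? ?]; apply/andP; split; lra.
have iaw : mu.-integrable `[0, 1] (EFin \o (fun r => a r * derive1 (v r) (Y s2))).
  by case: av => _ _ /(_ _ (Ypos _ s20 s2T)).
have vE : v s2 (Y s2) - v s1 (Y s2) =
    \int[mu]_(r in `]s1, s2]) (a r * derive1 (v r) (Y s2)).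
  have Y20 := Ypos _ s20 s2T.
  case: av => _ _ _ _ vE; rewrite vE ?s20 ?(le_trans s2T)// (vE s1)//.
  rewrite (@Rintegral_itv_split _ 1 s1 s2) ?(le_trans s2T)//; ring.
have ia12 : mu.-integrable `]s1, s2] (EFin \o a).
  by apply: integrableS ia => // r /=; rewrite !in_itv/= => /andP[? ?]; apply/andP; split; lra.
have iaw12 : mu.-integrable `]s1, s2] (EFin \o (fun r => a r * derive1 (v r) (Y s2))).
  by apply: integrableS iaw => // r /=; rewrite !in_itv/= => /andP[? ?]; apply/andP; split; lra.
have A12E : A s2 - A s1 = \int[mu]_(r in `]s1, s2]) a r.
  by rewrite !AE (@Rintegral_itv_split _ _ _ _ s10 s12 s2T ia); ring.
have wr r : s1 < r -> r <= s2 -> `|derive1 (v r) (Y s2) - w| < e / 2.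
  move=> r1 r2; apply: cw => //.
  - by apply/andP; split; lra.
  - exact: Ypos.
  - move: s1d1 s2d1; rewrite !ltr_norml => /andP[? ?] /andP[? ?].
    by apply/andP; split; lra.
have ub : \int[mu]_(r in `]s1, s2]) (a r * derive1 (v r) (Y s2)) <=
    (w + e / 2) * (A s2 - A s1).
  rewrite A12E -RintegralZl//; apply: le_Rintegral => //.
    by apply: (@integrableZl _ _ _ mu _ _ (w + e / 2) (EFin \o a)).
  move=> r /=; rewrite in_itv/= => /andP[r1 r2].
  rewrite mulrC ler_wpM2r ?a0//; first by apply/andP; split; lra.
  by have := wr _ r1 r2; rewrite ltr_norml => /andP[? ?]; lra.
have lb : (w - e / 2) * (A s2 - A s1) <=
    \int[mu]_(r in `]s1, s2]) (a r * derive1 (v r) (Y s2)).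
  rewrite A12E -RintegralZl//; apply: le_Rintegral => //.
    by apply: (@integrableZl _ _ _ mu _ _ (w - e / 2) (EFin \o a)).
  move=> r /=; rewrite in_itv/= => /andP[r1 r2].
  rewrite [leRHS]mulrC ler_wpM2r ?a0//; first by apply/andP; split; lra.
  by have := wr _ r1 r2; rewrite ltr_norml => /andP[? ?]; lra.
have Y12E : Y s1 - Y s2 = A s2 - A s1 by rewrite !YE; ring.
(* The two increments are each within [e / 2 * (A s2 - A s1)] of [w * (A s2 - A s1)], so the leading
   terms cancel in the difference. *)
rewrite (_ : _ - _ = (v s2 (Y s2) - v s1 (Y s2)) - (v s1 (Y s1) - v s1 (Y s2))); last by ring.
rewrite cE vE Y12E.
have dA0 : 0 <= A s2 - A s1 by rewrite subr_ge0.
move: dA0 ub lb; set dA := A s2 - A s1; set I := \int[mu]_(_ in _) _ => dA0 ub lb.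
move: wc; rewrite ltr_norml => /andP[wc1 wc2].
have : (derive1 (v s1) c - w) * dA <= e / 2 * dA by rewrite ler_wpM2r// ltW.
have : - (e / 2) * dA <= (derive1 (v s1) c - w) * dA by rewrite ler_wpM2r// ltW.
move: ub lb; rewrite !mulrDl !mulNr => ub lb h1 h2.
by rewrite ler_norml; apply/andP; split; lra.
Qed.

(** Chaining the local estimates bounds the change of [v] along [Y] by an arbitrarily small multiple
    of [A T], so [v] is constant there; [Y] runs from [y + A T] at time 0 to [y] at time [T].
    Integrability is asked only up to [T], which allows the use before integrability up to time 1 is
    known. *)
Lemma ts_characteristic a v (T y : R) : transport_solution a v ->
    (forall t, 0 <= t <= 1 -> 0 <= a t) ->
    0 <= T <= 1 -> mu.-integrable `[0, T] (EFin \o a) -> 0 < y ->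
  v T y = y + \int[mu]_(r in `[0, T]) a r.
Proof.
move=> av a0 T01 ia y0.
pose A t := \int[mu]_(r in `[0, t]) a r.
pose Y t := y + (A T - A t).
have /andP[T0 T1] := T01.
have A0 : A 0 = 0 by rewrite /A set_itv1 Rintegral_set1.
have AT0 : 0 <= A T.
  apply: Rintegral_ge0 => r /=; rewrite in_itv/= => /andP[r0 rT].
  by apply: a0; rewrite r0 (le_trans rT).
have YT : Y T = y by rewrite /Y subrr addr0.
have v0 : v 0 (Y 0) = Y 0.
  by case: av => _ _ _ + _; apply; rewrite /Y A0 subr0 ltr_pwDl.
suff : `|v T (Y T) - v 0 (Y 0)| <= 0.
  by rewrite normr_le0 subr_eq0 YT v0 /Y A0 subr0 => /eqP.
apply/ler_addgt0Pr => e e0; rewrite add0r.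
(* The summand 1 keeps the denominator positive when [A T] vanishes. *)
have e'0 : 0 < e / (A T + 1) by rewrite divr_gt0// ltr_wpDl.
have := @itv_chaining R T (fun s1 s2 => A s1 <= A s2 /\
  `|v s2 (Y s2) - v s1 (Y s1)| <= e / (A T + 1) * (A s2 - A s1)) T0.
move=> [].
- move=> p q r [pq vpq] [qr vqr]; split; first exact: le_trans pq qr.
  apply: le_trans (ler_distD (v q (Y q)) _ _) _.
  apply: le_trans (lerD vqr vpq) _.
  by rewrite -mulrDr (_ : A r - A q + (A q - A p) = A r - A p)//; ring.
- exact: ts_characteristic_loc.
- move=> _ /le_trans; apply.
  rewrite A0 subr0 mulrAC ler_pdivrMr ?ltr_wpDl//.
  by rewrite ler_pM2l// lerDl.
Qed.

Lemma derive1_id_plus (f : R -> R) (c y : R) : 0 < y ->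
  (forall z, 0 < z -> f z = z + c) -> derive1 f y = 1.
Proof.
move=> y0 fE; rewrite derive1E.
rewrite (_ : 'D_1 f y = 'D_1 (fun z => z + c) y); last first.
  apply: near_eq_derive.
  near=> z; apply: fE; near: z.
  exact: lt_nbhsr.
by rewrite deriveD// derive_id derive_cst addr0.
Unshelve. all: by end_near. Qed.

Lemma ts_derive1 a v (T y : R) : transport_solution a v ->
    (forall t, 0 <= t <= 1 -> 0 <= a t) ->
    0 <= T <= 1 -> mu.-integrable `[0, T] (EFin \o a) -> 0 < y ->
  derive1 (v T) y = 1.
Proof.
move=> av a0 T01 ia y0; apply: derive1_id_plus y0 _ => z z0.
exact: ts_characteristic av a0 T01 ia z0.
Qed.

(** Let [m] be the supremum of the times up to which [a] is integrable. Before [m] one has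
    [d_y v = 1], hence [d_y v >= 1/2] near [(m, 1)] by continuity, and there [a] is dominated by
    [2 * a * d_y v], which is integrable by the definition of a solution. Integrability therefore
    passes beyond [m] unless [m = 1], and it holds at [m] itself. *)
Lemma ts_integrable a v : transport_solution a v ->
    (forall t, 0 <= t <= 1 -> 0 <= a t) ->
    measurable_fun (`[0, 1] : set R) a ->
  mu.-integrable `[0, 1] (EFin \o a).
Proof.
move=> av a0 ma.
pose S := [set t | 0 <= t <= 1 /\ mu.-integrable `[0, t] (EFin \o a)].
have ma' (A : set R) : A `<=` `[0, 1] -> measurable_fun A (fun t => (a t)%:E).
  by move=> A01; apply/measurable_EFinP; exact: measurable_funS ma.
have S0 : S 0.
  split; first by rewrite lexx ler01.
  apply: null_set_integrable => //; last by rewrite set_itv1; exact: lebesgue_measure_set1.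
  by apply: ma' => r /=; rewrite !in_itv/= => /andP[? ?]; apply/andP; split; lra.
have ubS : ubound S 1 by move=> s [/andP[]].
have supS : has_sup S by split; [exists 0|exists 1].
have m0 : 0 <= sup S by apply: ub_le_sup => //; exists 1.
have m1 : sup S <= 1 by apply: ge_sup => //; exists 0.
have Sm s : S s -> s <= sup S by apply: ub_le_sup; exists 1.
have supm (e : R) (e0 : 0 < e) := sup_adherent e0 supS.
move: (sup S) m0 m1 Sm supm => m m0 m1 Sm supm {S0 ubS supS}.
have m01 : 0 <= m <= 1 by rewrite m0.
have [d d0 cw] : exists2 d : R, 0 < d & forall r y, 0 <= r <= 1 -> 0 < y ->
    `|r - m| < d -> `|y - 1| < d -> `|derive1 (v r) y - derive1 (v m) 1| < 4^-1.
  by apply: (ts_continuous av m01 ltr01); rewrite invr_gt0.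
(* It is not yet known that [m] lies in [S], so the argument starts from a nearby [s1] that does. *)
have [s1 [s101 is1] ms1] := supm _ d0.
have /andP[s10 s11] := s101.
have s1m : s1 <= m by apply: Sm; split.
have d1 : `|1 - 1 : R| < d by rewrite subrr normr0.
(* At [s1] the derivative is exactly 1, and [(s1, 1)] lies in the neighbourhood of [(m, 1)]. *)
have w1 : `|1 - derive1 (v m) 1| < 4^-1.
  rewrite -[X in `|X - _|](ts_derive1 av a0 s101 is1 ltr01); apply: cw => //.
  by clear -ms1 s1m d0; rewrite ltr_norml; apply/andP; split; lra.
(* The target time is half a radius past [m], capped at 1; [s2 <= m] can hold only through the
   cap. *)
have [s2 [s21 s2m ms2 s2E]] : exists s2, [/\ s2 <= 1, s2 <= m + d / 2, m <= s2
    & s2 <= m -> s2 = 1].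
  exists (Num.min 1 (m + d / 2)).
  split; [by rewrite ge_min lexx|by rewrite ge_min lexx orbT| |].
    by rewrite le_min m1 lerDl divr_ge0// ltW.
  by rewrite minElt; case: ifPn => // _; rewrite leNgt ltrDl divr_gt0.
have sub01 (r : R) : 0 <= r -> r <= s2 -> 0 <= r <= 1.
  by move=> r0 rs; rewrite r0 (le_trans rs).
(* Two errors below [1/4], from [r] to [m] and from [m] to [s1], leave at least [1/2]. *)
have w12 (r : R) : s1 < r -> r <= s2 -> 2^-1 <= derive1 (v r) 1.
  move=> r1 r2; have : `|derive1 (v r) 1 - derive1 (v m) 1| < 4^-1.
    apply: cw => //; first by apply: sub01 => //; rewrite (le_trans s10)// ltW.
    by clear -ms1 r1 r2 s2m d0; rewrite ltr_norml; apply/andP; split; lra.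
  by clear -w1; move: w1; rewrite !ltr_norml => /andP[? ?] /andP[? ?]; lra.
have sub12 (r : R) : r \in `]s1, s2]%R -> 0 <= r <= 1.
  rewrite in_itv/= => /andP[r1 r2]; apply: sub01 => //.
  by rewrite (le_trans s10)// ltW.
have maw : mu.-integrable `]s1, s2] (EFin \o (fun r => 2 * (a r * derive1 (v r) 1))).
  apply: (@integrableZl _ _ _ mu _ _ 2 (EFin \o (fun r => a r * derive1 (v r) 1))) => //.
  case: av => _ _ /(_ 1 ltr01) + _ _; apply: integrableS => // r /= /sub12.
have is2 : mu.-integrable `[0, s2] (EFin \o a).
  apply/integrableP; split.
    by apply: ma' => r /=; rewrite !in_itv/= => /andP[? ?]; exact: sub01.
  have s12 : s1 <= s2 := le_trans s1m ms2.
  rewrite (@itv_bndbnd_setU _ _ _ (BRight s1)) ?bnd_simp//.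
  rewrite ge0_integral_setU//; last 2 first.
  - apply: measurableT_comp => //; apply: ma' => r /= [|/sub12]; rewrite ?in_itv//=.
    by move=> /andP[? ?]; apply: sub01 => //; exact: le_trans s12.
  - apply/disj_setPS => r [/=]; rewrite !in_itv/= => /andP[_ rs] /andP[].
    by rewrite ltNge rs.
  rewrite lte_add_pinfty//; first by case/integrableP : is1.
  case/integrableP : maw => maw; apply: le_lt_trans.
  apply: ge0_le_integral => //.
  - by apply: measurableT_comp => //; apply: ma' => r /= /sub12; rewrite ?in_itv.
  - exact: measurableT_comp.
  - move=> r /= rs; have ar0 : 0 <= a r by apply: a0; exact: sub12.
    move: rs; rewrite in_itv/= => /andP[r1 r2].
    have wr := w12 _ r1 r2; clear -ar0 wr.
    rewrite lee_fin ger0_norm// ger0_norm; last first.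
      by rewrite mulr_ge0// mulr_ge0//; lra.
    have : a r * 2^-1 <= a r * derive1 (v r) 1 by rewrite ler_wpM2l.
    by move=> ?; lra.
have Ss2 : S s2 by split => //; rewrite s21 (le_trans m0).
by rewrite -(s2E (Sm _ Ss2)).
Qed.

Lemma ts_exists a : (forall t, 0 <= t <= 1 -> 0 <= a t) ->
  mu.-integrable `[0, 1] (EFin \o a) ->
  transport_solution a (fun t y => y + \int[mu]_(r in `[0, t]) a r).
Proof.
move=> a0 ia.
have d1 t y : derive1 (fun z : R => z + \int[mu]_(r in `[0, t]) a r) y = 1.
  by rewrite derive1E deriveD// derive_id derive_cst addr0.
split.
- by move=> t y _ _; apply: derivableD.
- rewrite (_ : (fun p : R * R => _) = cst 1).
    by apply: continuous_subspaceT => p; exact: cvg_cst.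
  by apply/funext => p; exact: d1.
- move=> y _; apply: eq_integrable ia => // r _ /=.
  by rewrite d1 mulr1.
- by move=> y _; rewrite set_itv1 Rintegral_set1 addr0.
- move=> t y _ _; rewrite set_itv1 Rintegral_set1 addr0; congr (_ + _).
  by apply: eq_Rintegral => r _; rewrite d1 mulr1.
Qed.

(** Every solution is [y + A(t)], so its limit at time 1 as [y] tends to [0+] is [A(1)]. This turns
    the constraint into a condition linear in [rho], and it is used only in that form afterwards. *)
Lemma transport_constraintP (gamma : R -> R) (rho : R -> R -> R) :
    (forall x, measurable_fun (`[0, 1] : set R) (rho ^~ x)) ->
    (forall t x, 0 <= t <= 1 -> 0 <= rho t x) ->
  transport_constraint gamma rho <->
  forall x, (\int[mu]_(t in `[0%R, 1%R]) (rho t x)%:E = (gamma x)%:E)%E.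
Proof.
move=> mrho rho0.
have cvgE (c l : R) : (y + c @[y --> 0^'+] --> l) <-> c = l.
  have cvgc : y + c @[y --> 0^'+] --> 0 + c.
    apply: cvgD; last exact: cvg_cst.
    by apply: cvg_at_right_filter; exact: cvg_id.
  split=> [cl|<-]; last by rewrite add0r in cvgc.
  rewrite add0r in cvgc.
  by apply: (cvg_unique _ cvgc cl); exact: norm_hausdorff.
have fin01 x : mu.-integrable `[0, 1] (EFin \o rho ^~ x) ->
    (\int[mu]_(t in `[0%R, 1%R]) (rho t x)%:E)%E =
    (\int[mu]_(t in `[0, 1]) (rho t x))%:E.
  by move=> /integrable_fin_num => h; rewrite /Rintegral fineK//; exact: h.
have vE v x : transport_solution (rho ^~ x) v ->
    mu.-integrable `[0, 1] (EFin \o rho ^~ x) /\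
    (v 1 y @[y --> 0^'+] --> gamma x <-> \int[mu]_(t in `[0, 1]) (rho t x) = gamma x).
  move=> vx; have rx0 t : 0 <= t <= 1 -> 0 <= rho t x by exact: rho0.
  have ix := ts_integrable vx rx0 (mrho x); split => //.
  rewrite -cvgE.
  have I01 : (0 : R) <= (1 : R) <= (1 : R) by rewrite ler01 lexx.
  split; apply: cvg_trans; apply: near_eq_cvg; near=> y.
    by rewrite (ts_characteristic vx rx0 I01 ix).
  by rewrite (ts_characteristic vx rx0 I01 ix).
split => [tc x|intE x].
  have [[v vx] /(_ v vx)] := tc x.
  by have [ix ->] := vE _ _ vx; rewrite fin01// => ->.
(* The extended integral equals the real number [gamma x], which already makes it finite. *)
have ix : mu.-integrable `[0, 1] (EFin \o rho ^~ x).
  apply/integrableP; split; first by apply/measurable_EFinP; exact: mrho.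
  rewrite [ltLHS](_ : _ = (gamma x)%:E) ?ltry// -intE; apply: eq_integral => t.
  by rewrite inE/= in_itv/= => t01; rewrite ger0_norm ?rho0.
split; first by eexists; apply: ts_exists ix => t; exact: rho0.
move=> v vx; have [_ ->] := vE _ _ vx.
by have := intE x; rewrite fin01// => -[].
Unshelve. all: by end_near. Qed.
End transport.

(** * Tangents and midpoint convexity of [x ln x] *)

Section xlogx.
Context {R : realType}.
Implicit Types a b x : R.

Definition xlogx x := x * ln x.

Lemma measurable_xlogx : measurable_fun [set: R] xlogx.
Proof. by apply: measurable_funM => //; exact: measurable_ln. Qed.

Lemma xlogx0 : xlogx 0 = 0.
Proof. by rewrite /xlogx mul0r. Qed.

(** The left side is the tangent at [b], that is [b ln b + (1 + ln b)(a - b)]. Strictness comes from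
    [exp u > 1 + u] at the nonzero point [u = ln b - ln a]. *)
Lemma xlogx_gt_tangent a b : 0 <= a -> 0 < b -> a != b ->
  a * ln b + (a - b) < xlogx a.
Proof.
move=> a0 b0 ab; rewrite /xlogx.
move: a0; rewrite le_eqVlt => /predU1P[<-|a0]; first by rewrite !mul0r; lra.
have ne0 : ln b - ln a != 0.
  apply: contra ab => /eqP h; apply/eqP.
  by apply: (@ln_inj R); rewrite ?posrE//; apply/esym/eqP; rewrite -subr_eq0 h.
have := expR_gt1Dx ne0.
rewrite expRD expRN !lnK ?posrE// => h.
have : a * (1 + (ln b - ln a)) < a * (b / a) by rewrite ltr_pM2l.
by rewrite mulrCA divff ?gt_eqF// mulr1 mulrDr mulrBr mulr1; lra.
Qed.

Lemma xlogx_ge_tangent a b : 0 <= a -> 0 < b -> a * ln b + (a - b) <= xlogx a.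
Proof.
move=> a0 b0; have [->|ab] := eqVneq a b; first by rewrite subrr addr0.
exact/ltW/xlogx_gt_tangent.
Qed.

(** The Jensen defect of [x ln x] at the midpoint. *)
Definition xlogx_gap a b := 2^-1 * (xlogx a + xlogx b) - xlogx (2^-1 * (a + b)).

(** In the sum of the tangent inequalities at the midpoint for [a] and for [b] the linear terms
    cancel; if [a] differs from the midpoint, one inequality is strict. *)
Lemma xlogx_gap_eq0 a b : 0 <= a -> 0 <= b -> xlogx_gap a b = 0 -> a = b.
Proof.
move=> a0 b0 gap0; apply/eqP; apply: contrapT => /negP ab.
have c0 : 0 < 2^-1 * (a + b) by move/eqP : ab; nra.
have ac : a != 2^-1 * (a + b) by apply: contra ab => /eqP ?; apply/eqP; lra.
have := xlogx_gt_tangent a0 c0 ac.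
have := xlogx_ge_tangent b0 c0.
by move: gap0; rewrite /xlogx_gap /(xlogx (2^-1 * _)); lra.
Qed.

Lemma xlogx_gap_ge0 a b : 0 <= a -> 0 <= b -> 0 <= xlogx_gap a b.
Proof.
move=> a0 b0; have [ab0|c0] := leP (2^-1 * (a + b)) 0.
  have -> : a = 0 by lra.
  have -> : b = 0 by lra.
  by rewrite /xlogx_gap addr0 mulr0 xlogx0 addr0 mulr0 subrr.
have := xlogx_ge_tangent a0 c0.
have := xlogx_ge_tangent b0 c0.
by rewrite /xlogx_gap /(xlogx (2^-1 * _)); lra.
Qed.

(** With [c] the midpoint, [a] and [b] are at most [2 c], so [x ln x <= x (ln 2 + ln c)] at both;
    averaging gives [c ln 2 + c ln c], and the gap subtracts [c ln c]. *)
Lemma xlogx_gap_le a b : 0 <= a -> 0 <= b ->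
  xlogx_gap a b <= ln 2 * (2^-1 * (a + b)).
Proof.
move=> a0 b0; have [ab0|c0] := leP (2^-1 * (a + b)) 0.
  have -> : a = 0 by lra.
  have -> : b = 0 by lra.
  by rewrite /xlogx_gap addr0 mulr0 xlogx0 addr0 mulr0 subrr mulr0.
have xle x : 0 <= x -> x <= a + b -> xlogx x <= x * (ln 2 + ln (2^-1 * (a + b))).
  move=> x0 xab; rewrite /xlogx -lnM ?posrE// mulrA divff ?pnatr_eq0// mul1r.
  move: x0; rewrite le_eqVlt => /predU1P[<-|x0]; first by rewrite !mul0r.
  by rewrite ler_pM2l// ler_ln ?posrE//; lra.
have ha : xlogx a <= a * (ln 2 + ln (2^-1 * (a + b))) by apply: xle => //; lra.
have hb : xlogx b <= b * (ln 2 + ln (2^-1 * (a + b))) by apply: xle => //; lra.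
by rewrite /xlogx_gap {3}/xlogx; lra.
Qed.

Lemma measurable_xlogx_gap d (T : measurableType d) (f g : T -> R) :
  measurable_fun setT f -> measurable_fun setT g ->
  measurable_fun setT (fun t => xlogx_gap (f t) (g t)).
Proof.
move=> mf mg; apply: measurable_funB; [apply: measurable_funM|] => //.
  by apply: measurable_funD; apply: measurableT_comp measurable_xlogx _.
apply: measurableT_comp; first exact: measurable_xlogx.
by apply: measurable_funM => //; exact: measurable_funD.
Qed.

End xlogx.

(** * Monotonicity and vanishing of integrals *)

Section integral_facts.
Local Open Scope ereal_scope.
Context d (T : measurableType d) (R : realType).
Variable mu : {measure set T -> \bar R}.

(* With the convention [+oo - +oo = -oo] the difference of the integrals of the
   positive and negative parts is monotone even when it is undefined. *)
Lemma le_integral_measurable (D : set T) (f g : T -> \bar R) : measurable D ->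
    measurable_fun D f -> measurable_fun D g -> (forall x, D x -> f x <= g x) ->
  \int[mu]_(x in D) f x <= \int[mu]_(x in D) g x.
Proof.
move=> mD mf mg fg; rewrite integralE [leRHS]integralE; apply: leeB.
- apply: ge0_le_integral => //; [exact: measurable_funepos|exact: measurable_funepos|].
  by move=> x /mem_set; apply: funepos_le => y /set_mem; exact: fg.
- apply: ge0_le_integral => //; [exact: measurable_funeneg|exact: measurable_funeneg|].
  by move=> x /mem_set; apply: funeneg_le => y /set_mem; exact: fg.
Qed.

Lemma integral_eq0_ae (D : set T) (f : T -> \bar R) : measurable D ->
    measurable_fun D f -> (forall x, D x -> 0 <= f x) ->
    \int[mu]_(x in D) f x = 0 ->
  {ae mu, forall x, D x -> f x = 0}.
Proof.
move=> mD mf f0 intf.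
have [h _] := ae_eq_integral_abs mu mD mf; apply: h; rewrite -[RHS]intf.
by apply: eq_integral => x; rewrite inE => Dx; rewrite gee0_abs// f0.
Qed.

End integral_facts.

(** * Invariance of Lebesgue measure under time rotation *)

Section rotation.
Context {R : realType}.
Local Notation mu := (@lebesgue_measure R).
Local Notation I01 := (`[0%R, 1%R]%classic : set (measurableTypeR R)).

(** Lebesgue measure is determined by its values on half-open intervals, where the translate is
    explicit. *)
Lemma lebesgue_measure_shift (c : R) (A : set (measurableTypeR R)) : measurable A ->
  pushforward mu ((fun t : R => c + t) : _ -> measurableTypeR R) A = mu A.
Proof.
have mc : measurable_fun setT ((fun t : R => c + t) : measurableTypeR R -> measurableTypeR R).
  by apply: measurable_funD => //; exact: measurable_cst.
move=> mA; apply/esym/lebesgue_measure_unique => //= _ [[a b]] _ <-.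
rewrite /pushforward (_ : _ @^-1` _ = `]a - c, b - c]%classic); last first.
  by apply/seteqP; split => x /=; rewrite !in_itv/= ltrBlDl lerBrDl.
rewrite !lebesgue_measure_itv/= !lte_fin ltrD2r; case: ifPn => // _.
by rewrite -!EFinB; congr (_%:E); ring.
Qed.

Local Open Scope ereal_scope.

Lemma ge0_integral_shift (c : R) (D : set (measurableTypeR R)) (f : R -> \bar R) :
    measurable D -> measurable_fun D f -> (forall t, D t -> 0 <= f t) ->
  \int[mu]_(t in (fun t : R => c + t)%R @^-1` D) f (c + t)%R = \int[mu]_(t in D) f t.
Proof.
move=> mD mf f0.
have mc : measurable_fun setT ((fun t : R => c + t)%R : measurableTypeR R -> measurableTypeR R).
  by apply: measurable_funD => //; exact: measurable_cst.
rewrite -(ge0_integral_pushforward mc mu mD mf); last first.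
  by move=> t /set_mem; exact: f0.
by apply: eq_measure_integral => //= A mA AS; exact: lebesgue_measure_shift.
Qed.

(* Addition modulo 1, except that a sum equal to 1 is kept. *)
Definition circle_add (s t : R) : R := (if s + t <= 1 then s + t else -1 + s + t)%R.

Lemma circle_addC s t : circle_add s t = circle_add t s.
Proof. by rewrite /circle_add (addrC t s) -!addrA (addrC s t). Qed.

Lemma circle_add01 s t : (0 <= s <= 1)%R -> (0 <= t <= 1)%R -> (0 <= circle_add s t <= 1)%R.
Proof.
move=> /andP[s0 s1] /andP[t0 t1]; rewrite /circle_add; case: ifPn => st.
  by rewrite addr_ge0.
by move: st; rewrite -ltNge => st; apply/andP; split; lra.
Qed.

Lemma measurable_circle_add2 : measurable_fun setT
  ((fun p => circle_add p.1 p.2) : measurableTypeR R * measurableTypeR R -> measurableTypeR R).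
Proof.
have mD : measurable_fun setT
    ((fun p => p.1 + p.2)%R : measurableTypeR R * measurableTypeR R -> measurableTypeR R).
  exact: measurable_funD.
apply: measurable_fun_ifT => //; first exact: measurable_fun_ler.
rewrite (_ : (fun p => _) = (fun p => -1 + (p.1 + p.2))%R).
  by apply: measurable_funD => //; exact: measurable_cst.
by apply/funext => p; rewrite addrA.
Qed.

Lemma measurable_circle_add s : measurable_fun setT
  (circle_add s : measurableTypeR R -> measurableTypeR R).
Proof. exact: (measurable_fun_pair2 s measurable_circle_add2). Qed.

(** Cut at [1 - s]: the lower piece is translated onto [[s, 1]], the upper one onto []0, s]]. The
    end points that do not match form a null set. *)
Lemma ge0_integral_circle_add (s : R) (f : R -> \bar R) : (0 <= s <= 1)%R ->
    measurable_fun setT f -> (forall t, 0 <= f t) ->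
  \int[mu]_(t in `[0%R, 1%R]) f (circle_add s t) = \int[mu]_(t in `[0%R, 1%R]) f t.
Proof.
move=> /andP[s0 s1] mf f0.
have mfD (D : set (measurableTypeR R)) : measurable_fun D f.
  by apply: measurable_funS mf.
have split01 (u : R) (g : R -> \bar R) : measurable_fun I01 g -> (forall t, 0 <= g t) ->
    (0 <= u)%R -> (u <= 1)%R -> \int[mu]_(t in `[0%R, 1%R]) g t =
    \int[mu]_(t in `[0%R, u]) g t + \int[mu]_(t in `]u, 1%R]) g t.
  move=> mg g0 u0 u1.
  rewrite (@itv_bndbnd_setU _ _ _ (BRight u)) ?bnd_simp//.
  rewrite ge0_integral_setU//.
    rewrite -itv_bndbnd_setU ?bnd_simp//.
  by apply/disj_setPS => r [/=]; rewrite !in_itv/= => /andP[_ ru] /andP[]; rewrite ltNge ru.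
have s'0 : (0 <= 1 - s)%R by rewrite subr_ge0.
have s'1 : (1 - s <= 1)%R by rewrite gerBl.
rewrite (split01 (1 - s)%R)//; last first.
  apply: measurable_funS (measurableT_comp mf (measurable_circle_add s)) => //.
rewrite [RHS](split01 s)// addeC; congr (_ + _).
- rewrite -[RHS]integral_itv_obnd_cbnd//; last exact: mfD.
  rewrite -[RHS](@ge0_integral_shift (-1 + s)%R)//.
  rewrite (_ : _ @^-1` _ = `](1 - s)%R, 1%R]%classic); last first.
    by apply/seteqP; split => x /=; rewrite !in_itv/= => /andP[? ?]; apply/andP; split; lra.
  apply: eq_integral => t; rewrite inE/= in_itv/= => /andP[t1 t2].
  by rewrite /circle_add ifF//; apply/negbTE; rewrite -ltNge; lra.
- rewrite integral_itv_obnd_cbnd//; last exact: mfD.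
  rewrite -[RHS](@ge0_integral_shift s)//.
  rewrite (_ : _ @^-1` _ = `[0%R, (1 - s)%R]%classic); last first.
    by apply/seteqP; split => x /=; rewrite !in_itv/= => /andP[? ?]; apply/andP; split; lra.
  apply: eq_integral => t; rewrite inE/= in_itv/= => /andP[t1 t2].
  by rewrite /circle_add ifT//; lra.
Qed.

End rotation.

(** * Densities on the time strip and the lower bound for the entropy *)

Section strip.
Context {R : realType}.
Local Notation mu := (@lebesgue_measure R).
Local Notation RR := (measurableTypeR R * measurableTypeR R)%type.
Implicit Types (r rho : R -> R -> R) (gamma : R -> R).

(** Extension by zero outside the unit time interval, so that the Fubini theorems apply on the whole
    plane. *)
Definition patch01 rho (t x : R) : R := if 0 <= t <= 1 then rho t x else 0.

Definition strip_density r :=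
  [/\ measurable_fun setT (fun p : RR => r p.1 p.2),
      forall t x, 0 <= r t x, forall t x, ~~ (0 <= t <= 1) -> r t x = 0
    & forall t : R, 0 <= t <= 1 -> (\int[mu]_x (r t x)%:E = 1)%E].

Lemma measurable_patch01 rho :
    measurable_fun ((`[0, 1]%classic : set (measurableTypeR R)) `*` [set: measurableTypeR R])
      (fun p => rho p.1 p.2) ->
  measurable_fun setT (fun p : RR => patch01 rho p.1 p.2).
Proof.
have mD : measurable ((`[0, 1]%classic : set (measurableTypeR R)) `*` [set: measurableTypeR R]).
  exact: measurableX.
move/(measurable_restrictT _ mD); congr (measurable_fun _ _); apply/funext => p.
rewrite patchE /patch01; case: ifPn.
  by rewrite inE => -[/=]; rewrite in_itv/= => ->.
rewrite notin_setE => h; case: ifPn => // p01; exfalso; apply: h.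
by split => //=; rewrite in_itv.
Qed.

Local Open Scope ereal_scope.

Lemma integral01_mkcond (G : R -> \bar R) :
    (forall t, ~~ (0 <= t <= 1)%R -> G t = 0) ->
  \int[mu]_(t in `[0%R, 1%R]) G t = \int[mu]_t G t.
Proof.
move=> G0; rewrite integral_mkcond; apply: eq_integral => t _.
rewrite patchE; case: ifPn => //; rewrite notin_setE/= in_itv/= => /negP h.
by rewrite G0.
Qed.

Lemma integral01_cst (c : R) : \int[mu]_(t in `[0%R, 1%R]) c%:E = c%:E.
Proof.
rewrite integral_cst//= lebesgue_measure_itv/= lte_fin ltr01.
by rewrite -EFinB subr0 mule1.
Qed.

(** Tonelli handles the positive and negative parts separately, and their difference is measurable
    even where it reads [+oo - +oo]. *)
Lemma measurable_integral_snd (f : RR -> \bar R) : measurable_fun setT f ->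
  measurable_fun setT (fun t : measurableTypeR R => \int[mu]_x f (t, x)).
Proof.
move=> mf.
rewrite (_ : (fun t => _) = (fun t => \int[mu]_x f^\+ (t, x)) \- (fun t => \int[mu]_x f^\- (t, x))).
  apply: emeasurable_funB.
    by apply: measurable_fun_fubini_tonelli_F => //; exact: measurable_funepos.
  by apply: measurable_fun_fubini_tonelli_F => //; exact: measurable_funeneg.
apply/funext => t; rewrite integralE; congr (_ - _); apply: eq_integral => x _.
  by rewrite !funeposE.
by rewrite !funenegE.
Qed.

Lemma measurable_ent_integrand d (T : measurableType d) (f : T -> R) :
  measurable_fun setT f -> measurable_fun setT (fun t => (f t * ln (f t))%:E).
Proof.
move=> mf; apply/measurable_EFinP.
exact: (measurableT_comp measurable_xlogx mf).
Qed.

Lemma measurable_ent r : measurable_fun setT (fun p : RR => r p.1 p.2) ->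
  measurable_fun setT (fun t : measurableTypeR R => ent (r t)).
Proof. by move=> mr; exact: (measurable_integral_snd (measurable_ent_integrand mr)). Qed.

Lemma strip_section r : strip_density r ->
  (forall t, measurable_fun setT (r t : measurableTypeR R -> R)) /\
  (forall x, measurable_fun setT (r ^~ x : measurableTypeR R -> R)).
Proof.
move=> [mr _ _ _]; split=> z.
  exact: (measurable_fun_pair2 z mr).
exact: (measurable_fun_pair1 z mr).
Qed.

Lemma integrable_strip r : strip_density r ->
  (mu \x mu).-integrable setT (fun p : RR => (r p.1 p.2)%:E) /\
  \int[mu \x mu]_p (r p.1 p.2)%:E = 1.
Proof.
move=> [mr r0 rout r1].
have mer : measurable_fun setT (fun p : RR => (r p.1 p.2)%:E) by apply/measurable_EFinP.
have intr : \int[mu \x mu]_p (r p.1 p.2)%:E = 1.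
  rewrite fubini_tonelli1//=; last by move=> p; rewrite lee_fin.
  rewrite /fubini_F/= -integral01_mkcond; last first.
    by move=> t t01; rewrite integral0_eq// => x _; rewrite rout.
  rewrite -[RHS](integral01_cst 1); apply: eq_integral => t.
  by rewrite inE/= in_itv/=; exact: r1.
split => //; apply/integrableP; split => //.
rewrite (_ : (fun p : RR => _) = (fun p : RR => (r p.1 p.2)%:E)) ?intr ?ltry//.
by apply/funext => p; rewrite gee0_abs// lee_fin.
Qed.

(** Both iterated integrals of [r] equal its integral over the strip: integrating in [x] first gives
    1, in [t] first the mass of [gamma]. *)
Lemma strip_mass gamma r : strip_density r ->
    (forall x, \int[mu]_(t in `[0%R, 1%R]) (r t x)%:E = (gamma x)%:E) ->
  \int[mu]_x (gamma x)%:E = 1.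
Proof.
move=> sr rgamma; have [_ <-] := integrable_strip sr.
have [mr r0 rout r1] := sr.
rewrite fubini_tonelli2//=; [|by apply/measurable_EFinP|by move=> p; rewrite lee_fin].
apply: eq_integral => x _; rewrite -rgamma integral01_mkcond// => t t01.
by rewrite rout.
Qed.

Lemma strip_patch_cst gamma : measurable_fun setT gamma -> (forall x, 0 <= gamma x)%R ->
  \int[mu]_x (gamma x)%:E = 1 -> strip_density (patch01 (fun _ => gamma)).
Proof.
move=> mg g0 g1; split.
- apply: measurable_patch01; apply: measurable_funTS.
  exact: (measurableT_comp mg).
- by move=> t x; rewrite /patch01; case: ifP.
- by move=> t x /negbTE t01; rewrite /patch01 t01.
- by move=> t t01; rewrite /patch01 t01.
Qed.

Lemma measurable_lne : measurable_fun setT (fun b : R => lne b%:E).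
Proof.
apply: measurable_fun_ifT.
- by apply: measurable_fun_ler => //; exact: measurable_cst.
- exact: measurable_cst.
- by apply/measurable_EFinP; exact: measurable_ln.
Qed.

#[local] Arguments lne : simpl never.

(** At a zero of [gamma] the factor [lne] is [-oo], and the product with 0 is 0, in accordance with
    [0 ln 0 = 0]. *)
Lemma ent_integrand_lne gamma (x : R) : (0 <= gamma x)%R ->
  ent_integrand gamma x = (gamma x)%:E * lne (gamma x)%:E.
Proof.
rewrite /ent_integrand le_eqVlt /lne => /predU1P[<-|b0].
  by rewrite lexx mul0r mul0e.
by rewrite leNgt b0/= EFinM.
Qed.

(** The tangent inequality reads [g1 + g2 <= r ln r] with [g1 = r ln gamma] and [g2 = r - gamma].
    Integrated in [t] first, [g1] gives [ent gamma]; [g2] has integral 0 because both masses are 1.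
    Integrated in [x] first, the right side gives the mean entropy. *)
Lemma ent_le_mean_ent gamma r : strip_density r ->
    (forall x, \int[mu]_(t in `[0%R, 1%R]) (r t x)%:E = (gamma x)%:E) ->
    measurable_fun setT gamma -> (forall x, 0 <= gamma x)%R ->
    mu.-integrable setT (ent_integrand gamma) ->
  ent gamma <= \int[mu]_(t in `[0%R, 1%R]) ent (r t).
Proof.
move=> sr rgamma mg g0 ig.
have [mr r0 rout r1] := sr.
have [mrt mrx] := strip_section sr.
have mer : measurable_fun setT (fun p : RR => (r p.1 p.2)%:E) by apply/measurable_EFinP.
have sg := strip_patch_cst mg g0 (strip_mass sr rgamma).
(* With [lne] the bound is [-oo] where [gamma] vanishes and [r] does not, so the tangent inequality
   survives there. *)
pose g1 (p : RR) := (r p.1 p.2)%:E * lne (gamma p.2)%:E.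
pose g2 (p : RR) := (r p.1 p.2)%:E - (patch01 (fun _ => gamma) p.1 p.2)%:E.
have mg1 : measurable_fun setT g1.
  apply: emeasurable_funM => //.
  apply: (measurableT_comp measurable_lne (g := fun p : RR => gamma p.2)).
  exact: measurableT_comp mg measurable_snd.
have rmean x : \int[mu]_t (r t x)%:E = (gamma x)%:E.
  by rewrite -rgamma integral01_mkcond// => t t01; rewrite rout.
(* [lne (gamma x)] does not depend on [t], so the time integral of the absolute value of [g1] is
   that of [ent_integrand gamma]. *)
have ig1 : (mu \x mu).-integrable setT g1.
  apply: (integrable21ltyP _ _ _).2 => //.
  rewrite (_ : (fun y => _) = fun x => `|ent_integrand gamma x|).
    by case/integrableP : ig.
  apply/funext => x; rewrite ent_integrand_lne// /g1/=.
  under eq_integral do rewrite abseM gee0_abs ?lee_fin//.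
  rewrite ge0_integralZr ?rmean//.
  - by rewrite abseM (gee0_abs (_ : 0 <= (gamma x)%:E)) ?lee_fin.
  - by apply/measurable_EFinP; exact: mrx.
  - by move=> t _; rewrite lee_fin.
have [ir intr] := integrable_strip sr.
have [igg intgg] := integrable_strip sg.
have ig2 : (mu \x mu).-integrable setT g2 by exact: integrableB.
have intg2 : \int[mu \x mu]_p g2 p = 0.
  by rewrite integralB// intr intgg subee.
have intg1 : \int[mu \x mu]_p g1 p = ent gamma.
  rewrite -integral21_prod_meas1//; apply: eq_integral => x _.
  rewrite ent_integrand_lne// /fubini_G/g1/=.
  rewrite /lne; case: ifPn => gx0.
    (* Here [r] has time integral 0 at [x], so its product with the constant [-oo] still integrates
       to 0. *)
    have gx : gamma x = 0%R by apply/eqP; rewrite eq_le gx0 g0.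
    under eq_integral do rewrite -[-oo]/(- +oo) muleN.
    rewrite integral_ge0N; last first.
      by move=> t _; rewrite mule_ge0// lee_fin.
    rewrite ge0_integralZr ?rmean ?gx ?mul0e ?oppe0//.
    - by apply/measurable_EFinP; exact: mrx.
    - by move=> t _; rewrite lee_fin.
  rewrite integralZr ?rmean//.
  apply/integrableP; split; first by apply/measurable_EFinP; exact: mrx.
  under eq_integral do rewrite gee0_abs ?lee_fin//.
  by rewrite rmean ltry.
rewrite -intg1 -[leLHS]adde0 -intg2 -integralD//.
have ig12 : (mu \x mu).-integrable setT (g1 \+ g2) by exact: integrableD.
rewrite -(integral12_prod_meas1 ig12) -integral01_mkcond; last first.
  move=> t t01; rewrite /fubini_F integral0_eq// => x _.
  by rewrite /g1 /g2/= rout// /patch01 (negbTE t01) mul0e add0e subee.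
(* [ent (r t)] may be infinite or rest on the convention for [+oo - +oo], so monotonicity is used in
   the form for measurable functions. *)
apply: le_integral_measurable => //.
- by apply: measurable_funTS; exact: measurable_fubini_F ig12.
- by apply: measurable_funTS; exact: measurable_ent.
move=> t; rewrite /= in_itv/= => t01.
apply: le_integral_measurable => //.
- exact: (measurable_fun_pair2 t (measurable_int _ ig12)).
- exact: (measurable_ent_integrand (mrt t)).
move=> x _; rewrite /g1 /g2/= /patch01 t01 /lne.
case: ifPn => [gx0|gx0]; last first.
  rewrite -ltNge in gx0.
  by rewrite -EFinB -EFinM -EFinD lee_fin xlogx_ge_tangent.
have gx : gamma x = 0%R by apply/eqP; rewrite eq_le gx0 g0.
have := r0 t x; rewrite le_eqVlt => /predU1P[rtx|rtx].
  by rewrite /ent_integrand gx -rtx mul0e subee// adde0 mul0r.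
by rewrite gt0_muleNy ?lte_fin// addNye leNye.
Qed.

End strip.

(** * Averaging a family with its rotation in time *)

Section mixing.
Context {R : realType}.
Local Notation mu := (@lebesgue_measure R).
Local Notation RR := (measurableTypeR R * measurableTypeR R)%type.
Local Open Scope ereal_scope.

(** The rotation preserves the measure on the unit interval, so the preimage of a null set is
    null. *)
Lemma ae_circle_add (P : R -> Prop) (s : R) : (0 <= s <= 1)%R ->
    {ae mu, forall t, (0 <= t <= 1)%R -> P t} ->
  {ae mu, forall t, (0 <= t <= 1)%R -> P (circle_add s t)}.
Proof.
move=> s01 [N [mN N0 PN]].
have mrN : measurable ((circle_add s : measurableTypeR R -> measurableTypeR R) @^-1` N).
  by rewrite -[X in measurable X]setTI; exact: measurable_circle_add.
exists (circle_add s @^-1` N `&` `[0%R, 1%R]); split; first exact: measurableI.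
- rewrite -integral_indic//.
  have := @ge0_integral_circle_add _ s (fun t => (\1_N t)%:E) s01.
  move=> -> //; last by apply/measurable_EFinP; exact: measurable_indic.
  rewrite integral_indic//; apply: (subset_measure0 _ _ _ N0) => //.
  exact: measurableI.
- move=> t /= /not_implyP[t01 nP]; split; last by rewrite /= in_itv.
  by apply: PN => /= h; apply: nP; apply: h; exact: circle_add01.
Qed.

Lemma integrable_circle_add (h : R -> \bar R) (s : R) : (0 <= s <= 1)%R ->
    measurable_fun setT h -> mu.-integrable `[0%R, 1%R] h ->
  mu.-integrable `[0%R, 1%R] (fun t => h (circle_add s t)) /\
  \int[mu]_(t in `[0%R, 1%R]) h (circle_add s t) = \int[mu]_(t in `[0%R, 1%R]) h t.
Proof.
move=> s01 mh /integrableP[_ ih]; split.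
  apply/integrableP; split.
    by apply: measurable_funTS; exact: measurableT_comp mh (measurable_circle_add s).
  apply: le_lt_trans ih; rewrite le_eqVlt; apply/orP; left; apply/eqP.
  apply: (ge0_integral_circle_add (f := abse \o h)) => //; first exact: measurableT_comp.
  by move=> t; exact: abse_ge0.
rewrite integralE [RHS]integralE; congr (_ - _).
  rewrite -[RHS](ge0_integral_circle_add s01)//; last exact: measurable_funepos.
  by apply: eq_integral => t _; rewrite !funeposE.
rewrite -[RHS](ge0_integral_circle_add s01)//; last exact: measurable_funeneg.
by apply: eq_integral => t _; rewrite !funenegE.
Qed.

(** When the difference of the two parts is finite and one of them is finite, so is the other. This
    links entropies that are well defined and finite to the integration lemmas. *)
Lemma integral_defined_integrable (D : set (measurableTypeR R)) (f : R -> \bar R) :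
    measurable D -> measurable_fun D f ->
  (integral_defined D f /\ \int[mu]_(x in D) f x \is a fin_num) <->
  mu.-integrable D f.
Proof.
move=> mD mf; split=> [[fdef ffin]|fi]; last first.
  split; last exact: integrable_fin_num.
  by left; exact: integral_funepos_lt_pinfty.
have pos0 : 0 <= \int[mu]_(x in D) f^\+ x by exact: integral_ge0.
have neg0 : 0 <= \int[mu]_(x in D) f^\- x by exact: integral_ge0.
have [posoo negoo] : \int[mu]_(x in D) f^\+ x < +oo /\ \int[mu]_(x in D) f^\- x < +oo.
  move: ffin fdef pos0 neg0; rewrite integralE.
  case: (\int[mu]_(x in D) f^\+ x) => [p| |];
  case: (\int[mu]_(x in D) f^\- x) => [q| |] //= _ [] //; rewrite ?ltry//.
apply/integrableP; split => //.
rewrite [ltLHS](_ : _ = \int[mu]_(x in D) (f^\+ x + f^\- x)); last first.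
  by apply: eq_integral => x _; rewrite -[LHS]/((abse \o f) x) fune_abse.
rewrite ge0_integralD//; [exact: lte_add_pinfty| |].
  exact: measurable_funepos.
exact: measurable_funeneg.
Qed.

Variables (gamma : R -> R) (r : R -> R -> R).
Hypothesis sr : strip_density r.
Hypothesis rgamma : forall x, \int[mu]_(t in `[0%R, 1%R]) (r t x)%:E = (gamma x)%:E.

(** The competitor against which a minimizer is tested. *)
Definition mix (s : R) := patch01 (fun t x => 2^-1 * (r t x + r (circle_add s t) x))%R.

Let mr : measurable_fun setT (fun p : RR => r p.1 p.2). Proof. by case: sr. Qed.

Let r0 t x : (0 <= r t x)%R. Proof. by case: sr => _ + _ _; apply. Qed.

Let mrt t : measurable_fun setT (r t : measurableTypeR R -> R).
Proof. by have [+ _] := strip_section sr; apply. Qed.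

Let mrx x : measurable_fun setT (r ^~ x : measurableTypeR R -> R).
Proof. by have [_ +] := strip_section sr; apply. Qed.

Let r1 t : (0 <= t <= 1)%R -> \int[mu]_x (r t x)%:E = 1.
Proof. by case: sr => _ _ _; apply. Qed.

Let mrrot s : measurable_fun setT (fun p : RR => r (circle_add s p.1) p.2).
Proof.
apply: (measurableT_comp (f := fun p : RR => r p.1 p.2)
  (g := fun p : RR => (circle_add s p.1, p.2) : RR)) => //.
apply: measurable_fun_pair; last exact: measurable_snd.
exact: measurableT_comp (measurable_circle_add s) measurable_fst.
Qed.

Lemma mix_strip s : (0 <= s <= 1)%R -> strip_density (mix s).
Proof.
move=> s01; split.
- apply: measurable_patch01; apply: measurable_funTS.
  by apply: measurable_funM => //; exact: measurable_funD.
- move=> t x; rewrite /mix /patch01; case: ifP => // _.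
  by rewrite mulr_ge0// addr_ge0.
- by move=> t x /negbTE t01; rewrite /mix /patch01 t01.
- move=> t t01; rewrite /mix /patch01 t01.
  under eq_integral do rewrite EFinM EFinD.
  have rot_t := circle_add01 s01 t01.
  have mE u : measurable_fun setT (fun x : measurableTypeR R => (r u x)%:E).
    by apply/measurable_EFinP; exact: mrt.
  rewrite ge0_integralZl_EFin//.
  + rewrite ge0_integralD// ?r1//; try by move=> x _; rewrite lee_fin.
    by rewrite -EFinD -EFinM; congr (_%:E); lra.
  + by move=> x _; rewrite -EFinD lee_fin addr_ge0.
  + exact: emeasurable_funD.
Qed.

Lemma mix_mean s x : (0 <= s <= 1)%R ->
  \int[mu]_(t in `[0%R, 1%R]) (mix s t x)%:E = (gamma x)%:E.
Proof.
move=> s01.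
transitivity (\int[mu]_(t in `[0%R, 1%R]) (2^-1%:E * ((r t x)%:E + (r (circle_add s t) x)%:E))).
  apply: eq_integral => t; rewrite inE/= in_itv/= => t01.
  by rewrite /mix /patch01 t01 EFinM EFinD.
have mE : measurable_fun setT (fun t : measurableTypeR R => (r t x)%:E).
  by apply/measurable_EFinP; exact: mrx.
have mE' : measurable_fun setT (fun t : measurableTypeR R => (r (circle_add s t) x)%:E).
  exact: measurableT_comp mE (measurable_circle_add s).
rewrite ge0_integralZl_EFin//.
- rewrite ge0_integralD//; try by move=> t _; rewrite lee_fin.
  + rewrite (ge0_integral_circle_add (f := fun t => (r t x)%:E))//; last first.
      by move=> t; rewrite lee_fin.
    by rewrite rgamma -EFinD -EFinM; congr (_%:E); lra.
  + exact: measurable_funTS.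
  + exact: measurable_funTS.
- by move=> t _; rewrite -EFinD lee_fin addr_ge0.
- by apply: measurable_funTS; exact: emeasurable_funD.
Qed.

Definition gap (s t x : R) : R := xlogx_gap (r t x) (r (circle_add s t) x).

Let mgap s : measurable_fun setT (fun p : RR => gap s p.1 p.2).
Proof. exact: measurable_xlogx_gap. Qed.

Let gap0 s t x : (0 <= gap s t x)%R. Proof. exact: xlogx_gap_ge0. Qed.

(** The gap is at most [ln 2] times the density [mix s t], whose mass is 1; the bound is uniform in
    [t], which later gives integrability in time. *)
Let integrable_gap s t : (0 <= s <= 1)%R -> (0 <= t <= 1)%R ->
  mu.-integrable setT (fun x => (gap s t x)%:E) /\
  \int[mu]_x (gap s t x)%:E <= (ln 2)%:E.
Proof.
move=> s01 t01; have [mm m0 _ m1] := mix_strip s01.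
have [mmt _] := strip_section (mix_strip s01).
have mg : measurable_fun setT (fun x : measurableTypeR R => (gap s t x)%:E).
  by apply/measurable_EFinP; exact: (measurable_fun_pair2 t (mgap s)).
have le2 : \int[mu]_x (gap s t x)%:E <= (ln 2)%:E.
  apply: (@le_trans _ _ (\int[mu]_x ((ln 2)%:E * (mix s t x)%:E))).
    apply: le_integral_measurable => //.
      by apply: measurable_funeM; apply/measurable_EFinP; exact: mmt.
    move=> x _; rewrite -EFinM lee_fin /mix /patch01 t01.
    exact: xlogx_gap_le.
  rewrite ge0_integralZl_EFin//.
  - by rewrite m1// mule1.
  - by move=> x _; rewrite lee_fin.
  - by apply/measurable_EFinP; exact: mmt.
  - by rewrite ln_ge0// ler1n.
split => //; apply/integrableP; split => //.
under eq_integral do rewrite gee0_abs ?lee_fin//.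
exact: le_lt_trans le2 (ltry _).
Qed.

Hypothesis ent_r : {ae mu, forall t, (0 <= t <= 1)%R ->
  mu.-integrable setT (ent_integrand (r t))}.
Hypothesis total_r : mu.-integrable `[0%R, 1%R] (fun t => ent (r t)).

(** Pointwise, the mixed integrand is the average of the two integrands minus the gap. All terms are
    integrable, so the identity integrates in [x] for almost every [t], then in [t]; rotation leaves
    the total entropy unchanged. *)
Lemma ent_mix s : (0 <= s <= 1)%R ->
  [/\ {ae mu, forall t, (0 <= t <= 1)%R ->
        mu.-integrable setT (ent_integrand (mix s t))},
      mu.-integrable `[0%R, 1%R] (fun t => ent (mix s t))
    & \int[mu]_(t in `[0%R, 1%R]) ent (mix s t) =
      \int[mu]_(t in `[0%R, 1%R]) ent (r t) -
      \int[mu]_(t in `[0%R, 1%R]) \int[mu]_x (gap s t x)%:E].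
Proof.
move=> s01.
pose j t := \int[mu]_x (gap s t x)%:E.
(* The value of [ent (mix s t)] at every time where [r t] and its rotation both have integrable
   entropy, hence almost everywhere. *)
pose k t := 2^-1%:E * (ent (r t) + ent (r (circle_add s t))) - j t.
have [mm _ _ _] := mix_strip s01.
have good : {ae mu, forall t, (0 <= t <= 1)%R ->
    mu.-integrable setT (ent_integrand (mix s t)) /\ ent (mix s t) = k t}.
  have ent_rot := ae_circle_add s01 ent_r.
  apply: (@filterS2 _ _ (ae_filter_ringOfSetsType mu) _ _ _ _ ent_r ent_rot) => t + + t01 => /(_ t01) it /(_ t01) irt.
  have [ig _] := integrable_gap s01 t01.
  have iD := integrableD measurableT it irt.
  have iZ := integrableZl measurableT 2^-1 iD.
  have mixE : ent_integrand (mix s t) = (fun x => 2^-1%:E *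
      ((ent_integrand (r t) \+ ent_integrand (r (circle_add s t))) x)) \- (fun x => (gap s t x)%:E).
    apply/funext => x; rewrite /ent_integrand/=; congr (_%:E).
    rewrite /mix /patch01 t01 /gap /xlogx_gap.
    by rewrite /xlogx; ring.
  split; first by rewrite mixE; exact: integrableB.
  by rewrite /ent mixE integralB// integralZl// integralD.
have mj : measurable_fun setT j.
  by apply: (measurable_integral_snd (f := fun p => (gap s p.1 p.2)%:E)); apply/measurable_EFinP.
have ij : mu.-integrable `[0%R, 1%R] j.
  apply/integrableP; split; first exact: measurable_funTS.
  apply: (@le_lt_trans _ _ (\int[mu]_(t in `[0%R, 1%R]) (ln 2)%:E)).
    apply: le_integral_measurable => //.
      by apply: measurable_funTS; exact: measurableT_comp.
    move=> t; rewrite /= in_itv/= => t01.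
    rewrite gee0_abs; first by have [] := integrable_gap s01 t01.
    by apply: integral_ge0 => x _; rewrite lee_fin.
  by rewrite integral01_cst ltry.
have [irot Erot] := integrable_circle_add s01 (measurable_ent mr) total_r.
have m01 : measurable (`[0%R, 1%R]%classic : set (measurableTypeR R)) by [].
have iD := integrableD m01 total_r irot.
have iZ := integrableZl m01 2^-1 iD.
have ik : mu.-integrable `[0%R, 1%R] k := integrableB m01 iZ ij.
have aek : {ae mu, forall t, (`[0%R, 1%R]%classic : set R) t -> ent (mix s t) = k t}.
  apply: (@filterS _ _ (ae_filter_ringOfSetsType mu) _ _ _ good) => t h.
  by rewrite /= in_itv/= => t01; have [] := h t01.
have me : measurable_fun (`[0%R, 1%R]%classic : set (measurableTypeR R)) (fun t => ent (mix s t)).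
  by apply: measurable_funTS; exact: measurable_ent.
have mk := measurable_int _ ik.
split.
- apply: (@filterS _ _ (ae_filter_ringOfSetsType mu) _ _ _ good) => t h t01.
  by have [] := h t01.
- apply/integrableP; split => //.
  case/integrableP : ik => _; rewrite [ltLHS](_ : _ = \int[mu]_(t in `[0%R, 1%R]) `|ent (mix s t)|)//.
  apply: ae_eq_integral => //; [exact: measurableT_comp|exact: measurableT_comp|].
  apply: (@filterS _ _ (ae_filter_ringOfSetsType mu) _ _ _ aek) => t h t01 /=.
  by rewrite h.
- transitivity (\int[mu]_(t in `[0%R, 1%R]) k t); first exact: ae_eq_integral.
  rewrite [LHS]integralB// integralZl// integralD// Erot.
  have /fineK <- := integrable_fin_num m01 total_r.
  by rewrite -EFinD -EFinM; congr (_%:E - _); lra.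
Qed.

End mixing.

(** * Rigidity when all the gaps vanish *)

Section mixing_equality.
Context {R : realType}.
Local Notation mu := (@lebesgue_measure R).
Local Notation RR := (measurableTypeR R * measurableTypeR R)%type.
Local Open Scope ereal_scope.

(** The hypothesis holds for each shift [s]. Tonelli moves [s] innermost: for almost every [(t, x)]
    the gap vanishes for almost every [s], so [r t x] equals its rotations for those [s], and their
    mean over [s] is [gamma x]. *)
Lemma gap_eq0_ae (gamma : R -> R) (r : R -> R -> R) : strip_density r ->
    (forall x, \int[mu]_(t in `[0%R, 1%R]) (r t x)%:E = (gamma x)%:E) ->
    (forall s, (0 <= s <= 1)%R ->
      \int[mu]_(t in `[0%R, 1%R]) \int[mu]_x (gap r s t x)%:E = 0) ->
  ae_eq_strip r (fun _ => gamma).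
Proof.
move=> sr rgamma gapr.
have [mr r0 _ _] := sr.
have [_ mrx] := strip_section sr.
have gap0 s t x : (0 <= gap r s t x)%R by exact: xlogx_gap_ge0.
(* The gap cut off to the unit square in [(s, t)], for Tonelli on the whole space. *)
pose K s t x : R :=
  if (0 <= s <= 1)%R && (0 <= t <= 1)%R then gap r s t x else 0%R.
have K0 s t x : 0 <= (K s t x)%:E by rewrite lee_fin /K; case: ifP.
have mK d (T : measurableType d) (f g h : T -> measurableTypeR R) :
    measurable_fun setT f -> measurable_fun setT g -> measurable_fun setT h ->
    measurable_fun setT (fun q => (K (f q) (g q) (h q))%:E).
  move=> mf mg mh.
  have m01 (u : T -> measurableTypeR R) : measurable_fun setT u ->
      measurable_fun setT (fun q => (0 <= u q <= 1)%R).
    by move=> m_u; apply: measurable_and; apply: measurable_fun_ler => //; exact: measurable_cst.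
  have mcomp (u w : T -> measurableTypeR R) :
      measurable_fun setT u -> measurable_fun setT w ->
      measurable_fun setT (fun q => r (u q) (w q)).
    move=> m_u m_w; apply: (measurableT_comp (f := fun p : RR => r p.1 p.2)
      (g := fun q => (u q, w q) : RR)) => //.
    exact: measurable_fun_pair.
  apply/measurable_EFinP; apply: measurable_fun_ifT => //.
    by apply: measurable_and; exact: m01.
  apply: measurable_xlogx_gap; apply: mcomp => //.
  apply: (measurableT_comp measurable_circle_add2 (g := fun q => (f q, g q) : RR)).
  exact: measurable_fun_pair.
pose G (p : RR) := \int[mu]_s (K s p.1 p.2)%:E.
have mG : measurable_fun setT G.
  apply: (measurable_fun_fubini_tonelli_F (fun q : RR * measurableTypeR R =>
    (K q.2 q.1.1 q.1.2)%:E)) => //.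
  by apply: mK => //; exact: measurableT_comp.
have G0 p : 0 <= G p by exact: integral_ge0.
have intG : \int[mu \x mu]_p G p = 0.
  rewrite fubini_tonelli1//.
  (* Two exchanges, first of [s] with [x] and then of [s] with [t], make [s] the outermost
     variable. *)
  transitivity (\int[mu]_t \int[mu]_s \int[mu]_x (K s t x)%:E).
    apply: eq_integral => t _.
    apply: esym; apply: (fubini_tonelli (fun q : RR => (K q.1 t q.2)%:E)) => //.
    by apply: mK => //; exact: measurable_cst.
  rewrite -(fubini_tonelli (fun q : RR => \int[mu]_x (K q.1 q.2 x)%:E)); last 2 first.
  - apply: (measurable_fun_fubini_tonelli_F (fun q : RR * measurableTypeR R =>
      (K q.1.1 q.1.2 q.2)%:E)) => //.
    by apply: mK => //; exact: measurableT_comp.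
  - by move=> q; exact: integral_ge0.
  apply: integral0_eq => s _ /=.
  have [s01|s01] := boolP (0 <= s <= 1)%R; last first.
    rewrite integral0_eq// => t _; rewrite integral0_eq// => x _.
    by rewrite /K (negbTE s01).
  rewrite -integral01_mkcond; last first.
    by move=> t t01; rewrite integral0_eq// => x _; rewrite /K (negbTE t01) andbF.
  rewrite -[RHS](gapr s s01); apply: eq_integral => t.
  rewrite inE/= in_itv/= => t01; apply: eq_integral => x _.
  by rewrite /K s01 t01.
have := integral_eq0_ae measurableT mG (fun p _ => G0 p) intG.
apply: (@filterS _ _ (ae_filter_ringOfSetsType _)) => -[t x] /= /(_ I) Ktx t01.
have mKtx : measurable_fun setT (fun s : measurableTypeR R => (K s t x)%:E).
  by apply: mK => //; exact: measurable_cst.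
have aes := integral_eq0_ae measurableT mKtx (fun s _ => K0 s t x) Ktx.
have mrt : measurable_fun setT (fun s : measurableTypeR R => (r s x)%:E).
  by apply/measurable_EFinP; exact: mrx.
(* [r t x] is written as the integral of a constant over [s], and [gamma x] as the integral over [s]
   of the family rotated by [t]; the roles of shift and time are exchanged by [circle_addC]. *)
apply: EFin_inj; rewrite -rgamma -(ge0_integral_circle_add t01)//; last first.
  by move=> s; rewrite lee_fin.
rewrite -[LHS]integral01_cst; apply: ae_eq_integral => //.
  apply: measurable_funTS; exact: measurableT_comp mrt (measurable_circle_add t).
apply: (@filterS _ _ (ae_filter_ringOfSetsType _) _ _ _ aes) => s.
rewrite /= in_itv/= => /(_ I) + s01; rewrite /K s01 t01/= => -[] gapst.
rewrite circle_addC; congr (_%:E).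
exact: xlogx_gap_eq0 gapst.
Qed.

End mixing_equality.

(** * Minimizers of the constrained problem *)

Section solutions.
Context {R : realType}.
Local Notation mu := (@lebesgue_measure R).
Local Notation RR := (measurableTypeR R * measurableTypeR R)%type.
Implicit Types (r rho : R -> R -> R) (gamma : R -> R).

Lemma smooth_measurable gamma : smooth gamma ->
  measurable_fun setT (gamma : measurableTypeR R -> measurableTypeR R).
Proof.
move=> sg; apply: continuous_measurable_fun => x.
apply: differentiable_continuous; apply/derivable1_diffP.
exact: sg 0%N x.
Qed.

Lemma patch01E rho (t : R) : 0 <= t <= 1 -> patch01 rho t = rho t.
Proof. by move=> t01; apply/funext => x; rewrite /patch01 t01. Qed.

Lemma total_ent_patch01 rho : total_ent (patch01 rho) = total_ent rho.
Proof.
by apply: eq_integral => t; rewrite inE/= in_itv/= => t01; rewrite patch01E.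
Qed.

Lemma admissible_strip gamma rho : admissible gamma rho ->
  strip_density (patch01 rho) /\
  forall x, (\int[mu]_(t in `[0%R, 1%R]) (patch01 rho t x)%:E = (gamma x)%:E)%E.
Proof.
move=> [[mrho rho0] rho1 trho].
have sr : strip_density (patch01 rho).
  split; first exact: measurable_patch01.
  - by move=> t x; rewrite /patch01; case: ifP => // t01; exact: rho0.
  - by move=> t x /negbTE t01; rewrite /patch01 t01.
  - by move=> t t01; rewrite patch01E// rho1.
split => // x.
have mrhox z : measurable_fun (`[0, 1]%classic : set R) (rho ^~ z).
  have [_ mr] := strip_section sr.
  apply: (eq_measurable_fun (patch01 rho ^~ z)).
    by move=> t; rewrite inE/= in_itv/= => t01; rewrite patch01E.
  by apply: measurable_funTS; exact: mr.
rewrite -((transport_constraintP gamma mrhox rho0).1 trho x).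
by apply: eq_integral => t; rewrite inE/= in_itv/= => t01; rewrite patch01E.
Qed.

Lemma strip_admissible gamma r : strip_density r ->
    (forall x, (\int[mu]_(t in `[0%R, 1%R]) (r t x)%:E = (gamma x)%:E)%E) ->
  admissible gamma r.
Proof.
move=> sr rgamma; have [mr r0 _ r1] := sr; split => //.
  by split => //; exact: measurable_funTS.
apply/transport_constraintP => // x; apply: measurable_funTS.
by have [_] := strip_section sr; exact.
Qed.

Lemma cst_admissible gamma : measurable_fun setT gamma -> (forall x, 0 <= gamma x) ->
    (\int[mu]_x (gamma x)%:E = 1)%E ->
  admissible gamma (fun _ => gamma).
Proof.
move=> mg g0 g1; split => //.
  by split => //; apply: measurable_funTS; exact: (measurableT_comp mg measurable_snd).
apply/transport_constraintP => // x.
exact: integral01_cst.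
Qed.

(** A finite total entropy makes [ent] finite at almost every time; as it is also well defined
    there, the entropy integrand is integrable. *)
Lemma solution_integrable gamma rho : is_solution gamma rho ->
  {ae mu, forall t, 0 <= t <= 1 ->
    mu.-integrable setT (ent_integrand (patch01 rho t))} /\
  mu.-integrable `[0, 1] (fun t => ent (patch01 rho t)).
Proof.
move=> [arho [rhodef Hdef] Hfin _].
have [sr _] := admissible_strip arho.
have [mr _ _ _] := sr; have [mrt _] := strip_section sr.
have m01 : measurable (`[0, 1]%classic : set (measurableTypeR R)) by [].
have EE : {in (`[0, 1]%classic : set (measurableTypeR R)),
    (fun t => ent (rho t)) =1 (fun t => ent (patch01 rho t))}.
  by move=> t; rewrite inE/= in_itv/= => t01; rewrite patch01E.
have mh : measurable_fun (`[0, 1]%classic : set (measurableTypeR R))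
    (fun t => ent (rho t)).
  apply: eq_measurable_fun (measurable_funTS (measurable_ent mr)) => t t01.
  by rewrite EE.
have ih : mu.-integrable `[0, 1] (fun t => ent (patch01 rho t)).
  by apply: eq_integrable EE _ => //; apply/integral_defined_integrable.
split => //.
apply: (@filterS2 _ _ (ae_filter_ringOfSetsType mu) _ _ _ _ rhodef
  (integrable_ae m01 ih)) => t + + t01 => /(_ t01) entdef /= entfin.
apply/integral_defined_integrable => //; first exact: measurable_ent_integrand (mrt t).
split; first by rewrite patch01E.
by apply: entfin; rewrite in_itv.
Qed.

(** Each mixed family is an admissible competitor whose total entropy is smaller by the integral of
    the gap, so minimality forces that integral to vanish for every shift. *)
Lemma solution_unique gamma rho : is_solution gamma rho ->
  ae_eq_strip rho (fun _ => gamma).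
Proof.
move=> srho; have [ent_r total_r] := solution_integrable srho.
have [arho _ Hfin Hmin] := srho.
have [sr rgamma] := admissible_strip arho.
suff : ae_eq_strip (patch01 rho) (fun _ => gamma).
  apply: (@filterS _ _ (ae_filter_ringOfSetsType _)) => p h p01.
  by rewrite -h// patch01E.
apply: (gap_eq0_ae sr rgamma) => s s01.
have [ent_m total_m mE] := ent_mix sr ent_r total_r s01.
have sm := mix_strip sr s01.
have [mm _ _ _] := sm; have [mmt _] := strip_section sm.
have m01 : measurable (`[0, 1]%classic : set (measurableTypeR R)) by [].
have : (min_total_ent gamma <= total_ent (mix (patch01 rho) s))%E.
  apply: ereal_inf_lbound; exists (mix (patch01 rho) s) => //; split.
    by apply: (strip_admissible sm) => x; exact: mix_mean.
  split.
    apply: (@filterS _ _ (ae_filter_ringOfSetsType mu) _ _ _ ent_m) => t im t01.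
    have [] // := (integral_defined_integrable measurableT
      (measurable_ent_integrand (mmt t))).2 (im t01).
  have [] // := (integral_defined_integrable m01
    (measurable_int _ total_m)).2 total_m.
rewrite -Hmin [leRHS]mE -/(total_ent (patch01 rho)) total_ent_patch01.
set J := (\int[mu]_(t in _) _)%E.
have J0 : (0 <= J)%E.
  apply: integral_ge0 => t _; apply: integral_ge0 => x _.
  by case: sr => _ r0 _ _; rewrite lee_fin xlogx_gap_ge0.
(* An infinite [J] would put [-oo] above the finite minimum; a finite one satisfies [H <= H - J], so
   it is 0. *)
move: Hfin J0; case: (total_ent rho) => // H _; case: J => [j| |]//.
by rewrite !lee_fin => j0 Hj; congr (_%:E); lra.
Qed.

(** The measures of the sections of a null set integrate to 0, so almost every section is null. *)
Lemma ae_xsection (P : RR -> Prop) :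
    {ae (mu \x mu)%E, forall p : RR, P p} ->
  {ae mu, forall t, {ae mu, forall x, P (t, x)}}.
Proof.
move=> [N [mN N0 PN]].
have := integral_eq0_ae (mu := mu) measurableT (measurable_fun_xsection mu mN)
  (fun t _ => measure_ge0 _ _) N0.
apply: (@filterS _ _ (ae_filter_ringOfSetsType mu)) => t /(_ I) tN0.
exists (xsection N t); split => //; first exact: measurable_xsection.
by move=> x /= nP; apply/xsectionP; exact: PN.
Qed.

Lemma ae01_exists (P : R -> Prop) : {ae mu, forall t, 0 <= t <= 1 -> P t} ->
  exists2 t, 0 <= t <= 1 & P t.
Proof.
move=> [N [mN N0 PN]]; apply: contrapT => nex.
have : (mu `[0%R, 1%R] <= mu N)%E.
  apply: le_measure; rewrite ?inE// => t; rewrite /= in_itv/= => t01.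
  by apply: PN => h; apply: nex; exists t => //; exact: h.
by rewrite N0 lebesgue_measure_itv/= lte_fin ltr01 oppr0 adde0 lee_fin ler10.
Qed.

(** Some single time [t] has both an integrable entropy integrand and [rho t = gamma] almost
    everywhere; integrability then transfers to [gamma]. *)
Lemma solution_ent gamma rho : measurable_fun setT gamma -> is_solution gamma rho ->
  mu.-integrable setT (ent_integrand gamma).
Proof.
move=> mg srho; have [ent_r _] := solution_integrable srho.
have [arho _ _ _] := srho.
have [sr _] := admissible_strip arho.
have [mrt _] := strip_section sr.
have secs := ae_xsection (solution_unique srho).
have [t t01 [it eqt]] : exists2 t, 0 <= t <= 1 &
    mu.-integrable setT (ent_integrand (patch01 rho t)) /\
    {ae mu, forall x, rho t x = gamma x}.
  apply: ae01_exists.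
  apply: (@filterS2 _ _ (ae_filter_ringOfSetsType mu) _ _ _ _ ent_r secs).
  move=> t h1 h2 t01; split; first exact: h1.
  apply: (@filterS _ _ (ae_filter_ringOfSetsType mu) _ _ _ h2) => x /=; exact.
have mig := measurable_ent_integrand mg.
apply/integrableP; split => //.
case/integrableP : it => _; congr (_ < _)%E.
apply: ae_eq_integral => //.
- by apply: measurableT_comp => //; exact: measurable_ent_integrand (mrt t).
- exact: measurableT_comp.
apply: (@filterS _ _ (ae_filter_ringOfSetsType mu) _ _ _ eqt) => x rx _.
by rewrite /ent_integrand patch01E// rx.
Qed.

(** The constant family has total entropy [ent gamma], as the time interval has length 1, and
    [ent_le_mean_ent] shows that no competitor does better. *)
Lemma cst_solution gamma : measurable_fun setT gamma -> (forall x, 0 <= gamma x) ->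
    (\int[mu]_x (gamma x)%:E = 1)%E -> mu.-integrable setT (ent_integrand gamma) ->
  is_solution gamma (fun _ => gamma) /\ min_total_ent gamma = ent gamma.
Proof.
move=> mg g0 g1 ig.
have [gdef gfin] : ent_defined gamma /\ ent gamma \is a fin_num.
  exact: (integral_defined_integrable measurableT (measurable_ent_integrand mg)).2 ig.
have ag := cst_admissible mg g0 g1.
have m01 : measurable (`[0, 1]%classic : set (measurableTypeR R)) by [].
have HE : total_ent (fun _ => gamma) = ent gamma.
  by rewrite /total_ent -(fineK gfin); exact: integral01_cst.
have gtot : total_ent_defined (fun _ => gamma).
  split; first by apply: aeW.
  have mc : measurable_fun (`[0, 1]%classic : set (measurableTypeR R))
      (fun _ : measurableTypeR R => ent gamma) by exact: measurable_cst.
  have [] // := (integral_defined_integrable m01 mc).2 _.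
  apply/integrableP; split => //.
  rewrite -(fineK gfin) /=; apply: le_lt_trans (ltry (`|fine (ent gamma)|)).
  by rewrite integral01_cst.
have minE : min_total_ent gamma = ent gamma.
  apply/eqP; rewrite eq_le; apply/andP; split.
    by apply: ereal_inf_lbound; exists (fun _ => gamma).
  apply: le_ereal_inf_tmp => _ [rho [arho _] <-].
  have [sr rgamma] := admissible_strip arho.
  by rewrite -total_ent_patch01; exact: ent_le_mean_ent.
split => //; split => //; first by rewrite HE.
by rewrite HE minE.
Qed.

End solutions.

Unset Implicit Arguments.

Theorem proposition5p7 (R : realType) (gamma : R -> R)
  (gamma_ge0 : forall x : R, 0 <= gamma x) (gamma_smooth : smooth gamma) :
  let mass_one := (\int[lebesgue_measure]_x (gamma x)%:E = 1)%E in
  let ent_finite := ent_defined gamma /\ ent gamma \is a fin_num in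
  ((exists rho : R -> R -> R, is_solution gamma rho) <-> mass_one /\ ent_finite) /\
  (mass_one /\ ent_finite ->
   [/\ is_solution gamma (fun _ : R => gamma),
       forall rho : R -> R -> R, is_solution gamma rho ->
         ae_eq_strip rho (fun _ : R => gamma)
     & min_total_ent gamma = ent gamma]).
Proof.
move=> mass_one ent_finite.
have mg := smooth_measurable gamma_smooth.
have ent_finiteP : ent_finite <->
    lebesgue_measure.-integrable setT (ent_integrand gamma).
  exact: (integral_defined_integrable measurableT (measurable_ent_integrand mg)).
have sol : mass_one /\ ent_finite ->
    is_solution gamma (fun _ => gamma) /\ min_total_ent gamma = ent gamma.
  by move=> [g1 /ent_finiteP ig]; exact: cst_solution.
split.
  split=> [[rho srho]|/sol[? _]]; last by exists (fun _ => gamma).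
  split; last by apply/ent_finiteP; exact: solution_ent srho.
  have [arho _ _ _] := srho.
  have [sr rgamma] := admissible_strip arho.
  exact: strip_mass rgamma.
move=> /sol[sg minE]; split => // rho srho.
exact: solution_unique.
Qed.
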